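(* $$\sum_{n\ge0}T(n)q^n=\sum_{n\ge0}\frac{q^{2n(n+1)}(q;q^2)_n(-q^{2n+2};q)_\infty}{(q^2;q^2)_n},$$ where $T(n)$ is the number of partitions $\lambda$ of $n$ such that: $m_j(\lambda)\le 1$ for odd $j$; $m_j(\lambda)=0$ for odd $j<R_1(\lambda)+2$; $m_j(\lambda)\ge2$ for even $j$ with $0<j<R_1(\lambda)$; and no two consecutive integers both appear as parts of $\lambda$.
   Context: $m_j(\lambda)$ is the multiplicity of $j$ in $\lambda$; $R_1(\lambda)$ is the largest part of multiplicity at least $2$, or $0$ if none. $(x;q)_n=\prod_{h=0}^{n-1}(1-xq^h)$, $(x;q)_0=1$, $(x;q)_\infty=\prod_{h\ge0}(1-xq^h)$; $T(0)=1$ (empty partition). *)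

(* Defs.v *)
(* Formal power series with integer coefficients are modelled
   as coefficient functions nat -> int; infinite sums/products are limits in
   the q-adic (coefficientwise eventually constant) topology. *)
From mathcomp Require Import all_boot all_order all_algebra.
Set Implicit Arguments. Unset Strict Implicit. Unset Printing Implicit Defensive.
Import GRing.Theory.

Definition fps := nat -> int.

Local Open Scope ring_scope.

Definition fone : fps := fun k => if k == 0%N then 1 else 0.
Definition fq (m : nat) : fps := fun k => if k == m then 1 else 0.
Definition fadd (a b : fps) : fps := fun k => a k + b k.
Definition fopp (a : fps) : fps := fun k => - a k.
Definition fmul (a b : fps) : fps := fun k => \sum_(i < k.+1) a i * b (k - i)%N.
Definition fprod (n : nat) (f : nat -> fps) : fps := foldr fmul fone (mkseq f n).
Definition fsum (n : nat) (f : nat -> fps) : fps := fun k => \sum_(i < n) f i k.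
Definition fpow (a : fps) (n : nat) : fps := fprod n (fun _ => a).

Definition qpoch (x b : fps) (n : nat) : fps :=
  fprod n (fun h => fadd fone (fopp (fmul x (fpow b h)))).

(* multiplicative inverse of a series with constant term 1:
   b_0 = 1, b_k = - sum_{i=1}^k a_i b_{k-i} *)
Fixpoint finv_seq (a : fps) (k : nat) : seq int :=
  match k with
  | 0 => [:: 1]
  | k'.+1 => let s := finv_seq a k' in
             rcons s (- \sum_(i < k'.+1) a i.+1 * nth 0 s (k' - i)%N)
  end.
Definition finv (a : fps) : fps := fun k => nth 0 (finv_seq a k) k.

Definition fconv (s : nat -> fps) (l : fps) : Prop :=
  forall k, exists M, forall m, (M <= m)%N -> s m k = l k.

Local Close Scope ring_scope.

(** * The partition count T(n)
    A partition of n is encoded by its multiplicity function j |-> m_j(lambda)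
    for 1 <= j <= n (all multiplicities are <= n). *)
Definition mult_of (n : nat) (m : {ffun 'I_n.+1 -> 'I_n.+1}) (j : nat) : nat :=
  if j < n.+1 then nat_of_ord (m (inord j)) else 0.

Definition R1 (n : nat) (f : nat -> nat) : nat := \max_(j < n.+1 | 1 < f j) j.

Definition T_ok (n : nat) (f : nat -> nat) : bool :=
  [&& f 0 == 0,
      \sum_(j < n.+1) j * f j == n,
      [forall j : 'I_n.+1, odd j ==> (f j <= 1)],
      [forall j : 'I_n.+1, (odd j && (j < R1 n f + 2)) ==> (f j == 0)],
      [forall j : 'I_n.+1, (~~ odd j && (0 < j < R1 n f)) ==> (1 < f j)] &
      [forall j : 'I_n.+1, ~~ ((0 < f j) && (0 < f j.+1))]].

Definition T (n : nat) : nat :=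
  #|[set m : {ffun 'I_n.+1 -> 'I_n.+1} | T_ok n (mult_of m)]|.

(* n-th summand, given P = (-q^{2n+2}; q)_oo *)
Definition term11 (P : fps) (n : nat) : fps :=
  fmul (fmul (fq (2 * n * (n + 1))) (qpoch (fq 1) (fq 2) n))
       (fmul P (finv (qpoch (fq 2) (fq 2) n))).

(* Main.v *)
(** Splitting the partitions counted by T according to R_1 = 2h, the parts up to
   2h are 2, 4, ..., 2h with multiplicity at least 2 and the others are at least
   2h+2, pairwise at distance at least 2, so the series of T is
     sum_{n,k} q^(2n^2+2n+2nk+k^2+k) / ((q^2;q^2)_n (q;q)_k).
   Expanding (-q^(2n+2);q)_oo by Euler's identity, the right-hand side becomes
     sum_{n,k} q^(2n^2+2n+2nk+k(k+1)/2+k) (q;q^2)_n / ((q^2;q^2)_n (q;q)_k).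
   With q^(2n+k) factored out of the terms, the two sums agree along each diagonal
   2n + k = m: both families of diagonal sums satisfy
     (1 - q^m) X_m = q^(2m-1) X_(m-1) + q^(2m-2) X_(m-2)
   with the same X_0 and X_1. *)
Require Import Defs.
From HB Require Import structures.
From mathcomp Require Import all_boot all_order all_algebra.
From mathcomp Require Import boolp.
From mathcomp Require Import ring zify.
Set Implicit Arguments. Unset Strict Implicit. Unset Printing Implicit Defensive.
(* [Defs] comes last: MathComp also has an [fprod] and a [finv]. *)
Import GRing.Theory Defs.
Local Open Scope ring_scope.

(** * The ring of power series *)

HB.instance Definition _ := gen_eqMixin fps.
HB.instance Definition _ := gen_choiceMixin fps.

(** Coefficients of a product below [K] can be computed on polynomial truncations, so commutativity
    and associativity of [fmul] come from [{poly int}]. *)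
Definition trunc_poly (K : nat) (a : fps) : {poly int} := \poly_(i < K) a i.

Lemma fmul_trunc (K k : nat) (a b : fps) : (k < K)%N ->
  fmul a b k = (trunc_poly K a * trunc_poly K b)`_k.
Proof.
move=> ltkK; rewrite coefM; apply: eq_bigr => i _; rewrite !coef_poly.
by rewrite !ifT //; have := ltn_ord i; lia.
Qed.

Lemma eq_fmul (k : nat) (a b c d : fps) :
    (forall i, (i <= k)%N -> a i = c i) -> (forall i, (i <= k)%N -> b i = d i) ->
  fmul a b k = fmul c d k.
Proof.
by move=> eq_ac eq_bd; apply: eq_bigr => i _; rewrite eq_ac ?eq_bd ?leq_subr // -ltnS.
Qed.

Lemma coefM_trunc (K k : nat) (a b c : fps) : (k < K)%N ->
  fmul a (fmul b c) k = (trunc_poly K a * (trunc_poly K b * trunc_poly K c))`_k.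
Proof.
move=> ltkK; rewrite coefM; apply: eq_bigr => i _.
rewrite coef_poly ifT; last by have := ltn_ord i; lia.
by rewrite (@fmul_trunc K) //; have := ltn_ord i; lia.
Qed.

Definition fzero : fps := fun=> 0.

Lemma faddA : associative fadd.
Proof. by move=> a b c; apply/funext => k; rewrite /fadd addrA. Qed.
Lemma faddC : commutative fadd.
Proof. by move=> a b; apply/funext => k; rewrite /fadd addrC. Qed.
Lemma fadd0 : left_id fzero fadd.
Proof. by move=> a; apply/funext => k; rewrite /fadd add0r. Qed.
Lemma faddN : left_inverse fzero fopp fadd.
Proof. by move=> a; apply/funext => k; rewrite /fadd /fopp addNr. Qed.
Lemma fmulC : commutative fmul.
Proof.
by move=> a b; apply/funext => k; rewrite !(@fmul_trunc k.+1) // mulrC.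
Qed.
Lemma fmulA : associative fmul.
Proof.
move=> a b c; apply/funext => k; rewrite [RHS](congr1 (@^~ k) (fmulC _ _)).
by rewrite !(@coefM_trunc k.+1) // mulrA mulrC.
Qed.
Lemma fmul1 : left_id fone fmul.
Proof.
move=> a; apply/funext => k; rewrite /fmul big_ord_recl /= mul1r subn0.
by rewrite big1 ?addr0 // => i _; rewrite mul0r.
Qed.
Lemma fmulDl : left_distributive fmul fadd.
Proof.
move=> a b c; apply/funext => k; rewrite /fadd /fmul -big_split.
by apply: eq_bigr => i _; rewrite mulrDl.
Qed.
Lemma fone_neq0 : fone != fzero.
Proof. by apply/eqP => /(congr1 (@^~ 0%N)). Qed.

HB.instance Definition _ := GRing.isZmodule.Build fps faddA faddC fadd0 faddN.
HB.instance Definition _ :=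
  GRing.Zmodule_isComNzRing.Build fps fmulA fmulC fmul1 fmulDl fone_neq0.

Implicit Types (a b c d : fps) (i j k m n s : nat).

Lemma fps_addE a b k : (a + b) k = a k + b k. Proof. by []. Qed.
Lemma fps_oppE a k : (- a) k = - a k. Proof. by []. Qed.
Lemma fps_mulE a b k : (a * b) k = \sum_(i < k.+1) a i * b (k - i)%N.
Proof. by []. Qed.

Lemma fps_sumE (I : Type) (r : seq I) (Q : pred I) (F : I -> fps) k :
  (\sum_(i <- r | Q i) F i) k = \sum_(i <- r | Q i) F i k.
Proof. by apply: (big_morph (fun a : fps => a k)). Qed.

Lemma fprodE n (F : nat -> fps) : fprod n F = \prod_(h < n) F h.
Proof.
rewrite /fprod -(big_mkord xpredT F) /index_iota subn0 /mkseq unlock /reducebig /=.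
by elim: (iota 0 n) => //= h l ->.
Qed.

Definition q : fps := fq 1.

Lemma fq_mulE m a k : (fq m * a) k = if (k < m)%N then 0 else a (k - m)%N.
Proof.
rewrite fps_mulE; case: ltnP => [ltkm | lemk].
  rewrite big1 // => i _; rewrite /fq ifF ?mul0r //.
  by apply/negbTE; have := ltn_ord i; lia.
rewrite (bigD1 (Ordinal (lemk : m < k.+1)%N)) //= /fq eqxx mul1r big1 ?addr0 //.
by move=> i ne_im; rewrite ifF ?mul0r //; apply: contraNF ne_im => /eqP ?; apply/eqP/val_inj.
Qed.

Lemma fqE m : fq m = q ^+ m.
Proof.
elim: m => [|m IH]; first by rewrite expr0; apply/funext => k.
rewrite exprS -IH; apply/funext => k; rewrite /q fq_mulE /fq.
by case: k => [|k] //=; rewrite subn1.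
Qed.

Lemma qpochE m e n : qpoch (fq m) (fq e) n = \prod_(h < n) (1 - q ^+ (m + e * h)).
Proof.
rewrite /qpoch fprodE; apply: eq_bigr => h _.
congr (1 - _); rewrite /fpow fprodE prodr_const card_ord.
by rewrite -[fmul _ _]/(fq m * fq e ^+ h) !fqE -exprM exprD.
Qed.

Lemma qpochNE m n : qpoch (fopp (fq m)) (fq 1) n = \prod_(h < n) (1 + q ^+ (m + h)).
Proof.
rewrite /qpoch fprodE; apply: eq_bigr => h _.
rewrite /fpow fprodE prodr_const card_ord.
by rewrite -[LHS]/(1 - (- fq m * q ^+ h)) mulNr opprK fqE exprD.
Qed.

(* Congruence modulo [q ^+ K]. *)
Definition eqm (K : nat) (a b : fps) := forall k, (k < K)%N -> a k = b k.

Lemma eqmW K a b : a = b -> eqm K a b. Proof. by move=> ->. Qed.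
Lemma eqm_sym K a b : eqm K a b -> eqm K b a.
Proof. by move=> e k /e. Qed.
Lemma eqm_trans K b a c : eqm K a b -> eqm K b c -> eqm K a c.
Proof. by move=> e f k h; rewrite e ?f. Qed.
Lemma eqmD K a b c d : eqm K a b -> eqm K c d -> eqm K (a + c) (b + d).
Proof. by move=> e f k h; rewrite !fps_addE e ?f. Qed.
Lemma eqmM K a b c d : eqm K a b -> eqm K c d -> eqm K (a * c) (b * d).
Proof.
by move=> e f k h; apply: eq_fmul => i hi; [apply: e | apply: f]; lia.
Qed.
Lemma eqmMl K a b c : eqm K b c -> eqm K (a * b) (a * c).
Proof. exact: eqmM. Qed.
Lemma eqm_sum K (I : finType) (Q : pred I) (F G : I -> fps) :
  (forall x, Q x -> eqm K (F x) (G x)) ->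
  eqm K (\sum_(x | Q x) F x) (\sum_(x | Q x) G x).
Proof. by move=> e k h; rewrite !fps_sumE; apply: eq_bigr => i /e; apply. Qed.

Lemma eqm_qX K m a : (K <= m)%N -> eqm K (q ^+ m * a) 0.
Proof. by move=> leKm k ltkK; rewrite -fqE fq_mulE ifT //; lia. Qed.

(** * Inverses of series with constant term 1, and cancellation *)

Lemma fps_mul0E a b : (a * b) 0%N = a 0%N * b 0%N.
Proof. by rewrite fps_mulE big_ord1. Qed.

Lemma size_finv_seq a k : size (finv_seq a k) = k.+1.
Proof. by elim: k => //= k IH; rewrite size_rcons IH. Qed.

Lemma nth_finv_seq a j k : (j <= k)%N -> nth 0 (finv_seq a k) j = finv a j.
Proof.
elim: k => [|k IH]; first by case: j.
rewrite leq_eqVlt => /predU1P[-> // | ltjk] /=.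
by rewrite nth_rcons size_finv_seq ltjk IH.
Qed.

Lemma finvS a k :
  finv a k.+1 = - \sum_(i < k.+1) a i.+1 * finv a (k - i)%N.
Proof.
rewrite {1}/finv /= nth_rcons size_finv_seq ltnn eqxx; congr (- _).
by apply: eq_bigr => i _; rewrite nth_finv_seq ?leq_subr.
Qed.

Lemma mul_finv a : a 0%N = 1 -> a * finv a = 1.
Proof.
move=> a0; apply/funext => -[|k]; first by rewrite fps_mul0E a0.
rewrite fps_mulE big_ord_recl a0 mul1r subn0 finvS.
by rewrite [X in _ + X](eq_bigr (fun i : 'I_k.+1 => a i.+1 * finv a (k - i)%N)) ?addNr.
Qed.

Lemma eqm_cancel K a b c : a 0%N = 1 -> eqm K (a * b) (a * c) -> eqm K b c.
Proof.
move=> /mul_finv a1 /(eqmMl (finv a)).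
by rewrite !mulrA (mulrC (finv a)) a1 !mul1r.
Qed.

Lemma fps_cancel a b c : a 0%N = 1 -> a * b = a * c -> b = c.
Proof.
move=> a0 e; apply/funext => k; apply: (@eqm_cancel k.+1 a) => //.
by rewrite e.
Qed.

(** * Series with gap conditions *)

Definition iq e n : fps := finv (qpoch (fq e) (fq e) n).

Lemma qX0 m : (0 < m)%N -> (1 - q ^+ m) 0%N = 1.
Proof. by case: m => // m _; rewrite -fqE. Qed.

Lemma qpoch0E m e n : (0 < m)%N -> qpoch (fq m) (fq e) n 0%N = 1.
Proof.
move=> m_gt0; rewrite qpochE; elim: n => [|n IH]; first by rewrite big_ord0.
by rewrite big_ord_recr /= fps_mul0E IH qX0 ?mulr1 ?addn_gt0 ?m_gt0.
Qed.

Lemma iq0 e : iq e 0 = 1.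
Proof. by rewrite -[LHS]mul1r; apply: mul_finv. Qed.

Lemma iqS e n : (0 < e)%N -> (1 - q ^+ (e * n.+1)) * iq e n.+1 = iq e n.
Proof.
move=> e_gt0; have q0 k := @qpoch0E e e k e_gt0.
apply: (fps_cancel (q0 n)); rewrite (mul_finv (q0 n)) mulrA.
have <- : qpoch (fq e) (fq e) n.+1 = qpoch (fq e) (fq e) n * (1 - q ^+ (e * n.+1)).
  by rewrite !qpochE big_ord_recr /= mulnS.
exact: mul_finv.
Qed.

(* A sufficient condition for the sum of the [f j] to converge. *)
Definition adapted (f : nat -> fps) := forall j, eqm j (f j) 0.

(* For adapted [f] the terms with [j > k] do not contribute to coefficient [k]. *)
Definition isum (f : nat -> fps) : fps := fun k => \sum_(j < k.+1) f j k.

Lemma adapted_qX (f : nat -> fps) (w : nat -> nat) :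
  (forall j, j <= w j)%N -> adapted (fun j => q ^+ w j * f j).
Proof. by move=> lew j; apply: eqm_qX. Qed.

Lemma isumE (f : nat -> fps) K M : adapted f -> (K <= M)%N ->
  eqm K (isum f) (\sum_(j < M) f j).
Proof.
move=> af leKM k ltkK; rewrite fps_sumE /isum.
rewrite -(big_mkord xpredT (f^~ k)) -(big_mkord xpredT (f^~ k)).
rewrite [RHS](@big_cat_nat _ _ _ k.+1) //=; last exact: leq_trans ltkK leKM.
rewrite [X in _ = _ + X]big_nat_cond [X in _ = _ + X]big1 ?addr0 //.
by move=> j /andP[/andP[ltkj _] _]; apply: af.
Qed.

(** Pattern of a first-part recurrence: the term with j+1 parts either keeps them all ([g]) or gives
    up one part [s] and leaves j parts ([h]). *)
Lemma isum_split (f g h : nat -> fps) s :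
    adapted f -> adapted g -> adapted h -> f 0%N = g 0%N ->
    (forall j, f j.+1 = g j.+1 + q ^+ s * h j) ->
  isum f = isum g + q ^+ s * isum h.
Proof.
move=> af ag ah fg0 fgS; apply/funext => k.
rewrite (@isumE f k.+1 k.+2) // fps_addE (@isumE g k.+1 k.+2) //.
have /(_ k (ltnSn _)) -> := eqmMl (q ^+ s) (@isumE h k.+1 k.+1 ah (leqnn _)).
rewrite -fps_addE !(big_ord_recl k.+1) fg0 -addrA mulr_sumr -big_split.
by apply: (congr1 (fun a : fps => a k)); congr (_ + _); apply: eq_bigr => j _; rewrite fgS.
Qed.

Lemma isum_eqm1 f s : adapted f -> f 0%N = 1 -> (forall j, eqm s (f j.+1) 0) ->
  eqm s (isum f) 1.
Proof.
move=> af f0 fS k ltks; rewrite (@isumE f s s.+1) // fps_sumE big_ord_recl f0.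
by rewrite big1 ?addr0 // => j _; apply: fS.
Qed.

(* [gap2 s] counts the partitions with parts at least [s] and differences at least 2;
   [gap1 s], by Euler's identity [(-q^s; q)_oo], those with distinct parts at least [s]. *)
Definition gap2_term s j : fps := q ^+ (s * j + j * j.-1) * iq 1 j.
Definition gap2 s : fps := isum (gap2_term s).
Definition gap1_term s j : fps := q ^+ (s * j + 'C(j, 2)) * iq 1 j.
Definition gap1 s : fps := isum (gap1_term s).

Lemma gap2_adapted s : (0 < s)%N -> adapted (gap2_term s).
Proof. by move=> s0; apply: adapted_qX => j; nia. Qed.
Lemma gap1_adapted s : (0 < s)%N -> adapted (gap1_term s).
Proof. by move=> s0; apply: adapted_qX => j; nia. Qed.

(** Either s is not a part, or it is and the others are at least s+2. On the terms this is 1 =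
    q^(j+1) + (1 - q^(j+1)), the last factor cancelling against 1/(q;q)_(j+1). *)
Lemma gap2_rec s : (0 < s)%N -> gap2 s = gap2 s.+1 + q ^+ s * gap2 s.+2.
Proof.
move=> s_gt0; apply: isum_split; try exact: gap2_adapted.
  by rewrite /gap2_term !muln0.
move=> j; rewrite /gap2_term -(iqS j (ltn0Sn 0)) mul1n /=.
rewrite (_ : s.+1 * j.+1 + j.+1 * j = s * j.+1 + j.+1 * j + j.+1)%N; last by ring.
rewrite !mulrA -[q ^+ s * _]exprD.
have -> : (s + (s.+2 * j + j * j.-1) = s * j.+1 + j.+1 * j)%N.
  by case: j => [|j] /=; ring.
by rewrite [q ^+ (_ + j.+1)]exprD; ring.
Qed.

Lemma gap1_rec s : (0 < s)%N -> gap1 s = (1 + q ^+ s) * gap1 s.+1.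
Proof.
move=> s_gt0; rewrite mulrDl mul1r; apply: isum_split; try exact: gap1_adapted.
  by rewrite /gap1_term !muln0.
move=> j; rewrite /gap1_term -(iqS j (ltn0Sn 0)) mul1n /=.
rewrite binS bin1 !mulrA -[q ^+ s * _]exprD.
rewrite (_ : s.+1 * j.+1 + ('C(j, 2) + j) = s * j.+1 + ('C(j, 2) + j) + j.+1)%N; last by ring.
rewrite (_ : s + (s.+1 * j + 'C(j, 2)) = s * j.+1 + ('C(j, 2) + j))%N; last by ring.
by rewrite [q ^+ (_ + j.+1)]exprD; ring.
Qed.

Lemma gap1_prod s m : (0 < s)%N ->
  gap1 s = (\prod_(h < m) (1 + q ^+ (s + h))) * gap1 (s + m).
Proof.
move=> s_gt0; elim: m => [|m IH]; first by rewrite big_ord0 mul1r addn0.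
by rewrite IH gap1_rec ?addn_gt0 ?s_gt0 // big_ord_recr /= mulrA addnS.
Qed.

Lemma gap1_eqm1 s : (0 < s)%N -> eqm s (gap1 s) 1.
Proof.
move=> s_gt0; apply: isum_eqm1; first exact: gap1_adapted.
  by rewrite /gap1_term muln0 iq0 mulr1.
by move=> j; apply: eqm_qX; nia.
Qed.

Lemma gap2_eqm1 s : (0 < s)%N -> eqm s (gap2 s) 1.
Proof.
move=> s_gt0; apply: isum_eqm1; first exact: gap2_adapted.
  by rewrite /gap2_term muln0 iq0 mulr1.
by move=> j; apply: eqm_qX; nia.
Qed.

(** By [gap1_prod], [gap1 s] is the m-th partial product times [gap1 (s + m)], which is 1 modulo
    q^(s+m): this is Euler's identity. *)
Lemma gap1_conv s : (0 < s)%N -> fconv (fun m => qpoch (fopp (fq s)) (fq 1) m) (gap1 s).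
Proof.
move=> s_gt0 k; exists k.+1 => m lekm; rewrite qpochNE (gap1_prod m s_gt0).
have := eqmMl (\prod_(h < m) (1 + q ^+ (s + h))) (@gap1_eqm1 (s + m) _).
by rewrite mulr1 => -> //; lia.
Qed.

(** * Comparison along the diagonals 2n + k = m *)

(** Entry with k = m - 2n on the diagonal 2n + k = m; the test guards against truncated
    subtraction. *)
Definition diag (u : nat -> nat -> fps) n m : fps :=
  if (2 * n <= m)%N then u n (m - 2 * n)%N else 0.

Definition diag_sum u M m : fps := \sum_(n < M) diag u n m.

Lemma sum_diag (u : nat -> nat -> fps) M :
  eqm M (\sum_(n < M) \sum_(j < M) q ^+ (2 * n + j) * u n j)
        (\sum_(m < M) q ^+ m * diag_sum u M m).
Proof.
have -> : \sum_(m < M) q ^+ m * diag_sum u M m =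
    \sum_(n < M) \sum_(m < M) q ^+ m * diag u n m.
  by rewrite exchange_big; apply: eq_bigr => m _; rewrite /diag_sum mulr_sumr.
apply: eqm_sum => n _ k ltkM; rewrite !fps_sumE.
pose F m := (q ^+ m * diag u n m) k.
rewrite -(big_mkord xpredT F).
(* Raising the bound to 2n+M only adds multiples of q^M; the terms with m < 2n vanish, so m - 2n
   then runs over exactly [M] values. *)
have -> : \sum_(0 <= m < M) F m = \sum_(0 <= m < 2 * n + M) F m.
  rewrite [RHS](@big_cat_nat _ _ _ M) ?leq_addl //=.
  rewrite [X in _ = _ + X]big_nat_cond [X in _ = _ + X]big1 ?addr0 //.
  by move=> j /andP[/andP[leMj _] _]; apply: (eqm_qX _ leMj).
rewrite [RHS](@big_cat_nat _ _ _ (2 * n)) ?leq_addr //=.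
rewrite [X in _ = X + _]big_nat_cond [X in _ = X + _]big1 ?add0r; last first.
  by move=> j /andP[/andP[_ lej] _]; rewrite /F /diag leqNgt lej mulr0.
rewrite -[X in \sum_(X <= _ < _) _]add0n (big_addn 0) addKn big_mkord.
by apply: eq_bigr => j _; rewrite /F /diag leq_addl addnK addnC.
Qed.

Lemma diag0_gt u n m : (m < 2 * n)%N -> diag u n m = 0.
Proof. by rewrite /diag ltnNge => /negbTE ->. Qed.

(** * Recurrences for the two families of diagonal sums *)

Definition tterm n j : fps := q ^+ (2 * n * n + 2 * n * j + j * j) * (iq 2 n * iq 1 j).

Definition ratio n : fps := qpoch (fq 1) (fq 2) n * iq 2 n.
(** [tterm] and [sterm] are the summands of the double series for T and for the right-hand side
    after Euler's expansion, with q^(2n+k) divided out. *)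
Definition sterm n j : fps :=
  q ^+ (2 * n * n + 2 * n * j + 'C(j.+1, 2)) * (ratio n * iq 1 j).

Lemma ratioS n : (1 - q ^+ (2 * n.+1)) * ratio n.+1 = (1 - q ^+ (2 * n).+1) * ratio n.
Proof.
rewrite /ratio -(iqS n (ltn0Sn 1)) !qpochE big_ord_recr /= add1n.
by ring.
Qed.

Lemma ttermS1 n j :
  (1 - q ^+ (2 * n.+1)) * tterm n.+1 j = q ^+ (4 * n + 2 + 2 * j) * tterm n j.
Proof.
rewrite /tterm -(iqS n (ltn0Sn 1)) mulrA [RHS]mulrA -exprD.
rewrite (_ : 2 * n.+1 * n.+1 + 2 * n.+1 * j + j * j =
  4 * n + 2 + 2 * j + (2 * n * n + 2 * n * j + j * j))%N; last by ring.
by ring.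
Qed.

Lemma ttermS2 n j :
  (1 - q ^+ j.+1) * tterm n j.+1 = q ^+ (2 * n + 2 * j + 1) * tterm n j.
Proof.
rewrite /tterm -(iqS j (ltn0Sn 0)) mul1n mulrA [RHS]mulrA -exprD.
rewrite (_ : 2 * n * n + 2 * n * j.+1 + j.+1 * j.+1 =
  2 * n + 2 * j + 1 + (2 * n * n + 2 * n * j + j * j))%N; last by ring.
by ring.
Qed.

Lemma stermS1 n j :
  (1 - q ^+ (2 * n.+1)) * sterm n.+1 j =
  q ^+ (4 * n + 2 + 2 * j) * ((1 - q ^+ (2 * n).+1) * sterm n j).
Proof.
have -> : (1 - q ^+ (2 * n.+1)) * sterm n.+1 j =
    q ^+ (2 * n.+1 * n.+1 + 2 * n.+1 * j + 'C(j.+1, 2)) *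
    (((1 - q ^+ (2 * n.+1)) * ratio n.+1) * iq 1 j) by rewrite /sterm; ring.
rewrite ratioS /sterm.
rewrite (_ : 2 * n.+1 * n.+1 + 2 * n.+1 * j + 'C(j.+1, 2) =
  4 * n + 2 + 2 * j + (2 * n * n + 2 * n * j + 'C(j.+1, 2)))%N; last by ring.
by rewrite exprD; ring.
Qed.

Lemma stermS2 n j :
  (1 - q ^+ j.+1) * sterm n j.+1 = q ^+ (2 * n + j.+1) * sterm n j.
Proof.
rewrite /sterm -(iqS j (ltn0Sn 0)) mul1n mulrA [RHS]mulrA -exprD.
rewrite (binS j.+1) bin1.
rewrite (_ : 2 * n * n + 2 * n * j.+1 + ('C(j.+1, 2) + j.+1) =
  2 * n + j.+1 + (2 * n * n + 2 * n * j + 'C(j.+1, 2)))%N; last by ring.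
by ring.
Qed.

(** On the diagonal m the exponent 4n+2+2k equals 2m+2, free of n, so it can leave the sum over n.
    For [sterm], [v] carries the additional factor 1 - q^(2n+1). *)
Lemma diag_shift1 (u v : nat -> nat -> fps) n m :
    (forall n j, (1 - q ^+ (2 * n.+1)) * u n.+1 j = q ^+ (4 * n + 2 + 2 * j) * v n j) ->
  (1 - q ^+ (2 * n.+1)) * diag u n.+1 m.+2 = q ^+ (2 * m + 2) * diag v n m.
Proof.
move=> uS; rewrite /diag mulnS add2n !ltnS !subSS.
case: ifP => [le_nm | _]; last by rewrite !mulr0.
have := uS n (m - 2 * n)%N; rewrite mulnS add2n => ->.
by congr (q ^+ _ * _); lia.
Qed.

(** With m+1 = 2n + (k+1), the left factor is q^(2n) (1 - q^(k+1)). *)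
Lemma diag_shift2 (u : nat -> nat -> fps) (w : nat -> nat -> nat) n m :
    (forall n j, (1 - q ^+ j.+1) * u n j.+1 = q ^+ w n j * u n j) ->
  (q ^+ (2 * n) - q ^+ m.+1) * diag u n m.+1 =
  q ^+ (2 * n + w n (m - 2 * n)%N) * diag u n m.
Proof.
move=> uS; rewrite /diag; case: (leqP (2 * n) m) => [le_nm | lt_mn].
  rewrite (leqW le_nm) subSn // exprD -mulrA -uS.
  rewrite (_ : m.+1 = 2 * n + (m - 2 * n).+1)%N; last by lia.
  by rewrite exprD; ring.
(* For 2n > m only the entry 2n = m+1, that is k = 0 on the next diagonal, can be nonzero, and its
   factor is zero. *)
rewrite mulr0; case: ifP => [le_nm | _]; last by rewrite mulr0.
by rewrite (_ : 2 * n = m.+1)%N ?subrr ?mul0r //; lia.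
Qed.

(* Splits [1 - q^m] as [(1 - q^(2n)) + q^(2n) (1 - q^k)] where [m = 2n + k]. *)
Lemma diag_sumS (u v : nat -> nat -> fps) M m :
    (forall n j, (1 - q ^+ (2 * n.+1)) * u n.+1 j = q ^+ (4 * n + 2 + 2 * j) * v n j) ->
    (m < M)%N ->
  (1 - q ^+ m.+2) * diag_sum u M.+1 m.+2 =
    q ^+ (2 * m + 2) * diag_sum v M.+1 m +
    \sum_(n < M.+1) (q ^+ (2 * n) - q ^+ m.+2) * diag u n m.+2.
Proof.
move=> uS ltmM.
transitivity (\sum_(n < M.+1) ((1 - q ^+ (2 * n)) * diag u n m.+2 +
                              (q ^+ (2 * n) - q ^+ m.+2) * diag u n m.+2)).
  by rewrite mulr_sumr; apply: eq_bigr => n _; ring.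
rewrite big_split; congr (_ + _).
(* The summand n = 0 drops out as 1 - q^0 = 0. After the shift of n the top entry [diag v M m] is
   missing, but it is zero because m < 2M. *)
rewrite big_ord_recl /= muln0 expr0 subrr mul0r add0r mulr_sumr big_ord_recr /=.
rewrite [diag v M m]diag0_gt ?mulr0 ?addr0; last by lia.
by apply: eq_bigr => n _; exact: diag_shift1.
Qed.

Lemma diag_sum_tterm_rec M m : (m < M)%N ->
  (1 - q ^+ m.+2) * diag_sum tterm M.+1 m.+2 =
  q ^+ (2 * m + 2) * diag_sum tterm M.+1 m + q ^+ (2 * m + 3) * diag_sum tterm M.+1 m.+1.
Proof.
move=> ltmM; rewrite (diag_sumS ttermS1 ltmM); congr (_ + _).
rewrite mulr_sumr; apply: eq_bigr => n _.
rewrite (diag_shift2 _ _ ttermS2).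
(* Here 2n + (2n + 2k + 1) = 2m+3 for k = m+1-2n, again free of n. *)
case: (leqP (2 * n) m.+1) => [le_nm | lt_mn]; last by rewrite diag0_gt ?mulr0.
by congr (q ^+ _ * _); lia.
Qed.

(** The step in k now gives a power depending on n, so sums weighted by q^(2n) appear. One comes
    from applying that step twice, the other from the factor 1 - q^(2n+1); both are q^(2m+3) times
    the same weighted sum, with opposite signs, and cancel. *)
Lemma diag_sum_sterm_rec M m : (m < M)%N ->
  (1 - q ^+ m.+2) * diag_sum sterm M.+1 m.+2 =
  q ^+ (2 * m + 2) * diag_sum sterm M.+1 m + q ^+ (2 * m + 3) * diag_sum sterm M.+1 m.+1.
Proof.
move=> ltmM; rewrite (diag_sumS stermS1 ltmM).
have shift k n : (q ^+ (2 * n) - q ^+ k.+1) * diag sterm n k.+1 =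
    q ^+ k.+1 * (q ^+ (2 * n) * diag sterm n k).
  rewrite (diag_shift2 _ _ stermS2).
  case: (leqP (2 * n) k) => [le_nk | lt_kn]; last by rewrite diag0_gt ?mulr0.
  by rewrite mulrA -exprD; congr (q ^+ _ * _); lia.
under eq_bigr do rewrite shift.
rewrite -mulr_sumr.
have -> : \sum_(n < M.+1) q ^+ (2 * n) * diag sterm n m.+1 =
    q ^+ m.+1 * diag_sum sterm M.+1 m.+1 +
    q ^+ m.+1 * \sum_(n < M.+1) q ^+ (2 * n) * diag sterm n m.
  rewrite !mulr_sumr -big_split; apply: eq_bigr => n _.
  by rewrite /= -shift; ring.
have -> : diag_sum (fun n j => (1 - q ^+ (2 * n).+1) * sterm n j) M.+1 m =
    diag_sum sterm M.+1 m - q * \sum_(n < M.+1) q ^+ (2 * n) * diag sterm n m.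
  rewrite mulr_sumr -sumrB; apply: eq_bigr => n _; rewrite /diag.
  by case: ifP => _; rewrite ?exprS; ring.
rewrite (_ : 2 * m + 3 = m.+2 + m.+1)%N; last by lia.
rewrite (_ : 2 * m + 2 = m.+1 + m.+1)%N; last by lia.
by rewrite !exprD !exprS; ring.
Qed.

Lemma diag_sum_small (u : nat -> nat -> fps) M m : (m < 2)%N -> diag_sum u M.+1 m = u 0%N m.
Proof.
move=> lem1; rewrite /diag_sum big_ord_recl big1 ?addr0 => [|n _].
  by rewrite /diag muln0 subn0.
by rewrite diag0_gt // lift0; lia.
Qed.

(** Both sides satisfy the same second-order recurrence with cancellable leading factor, so it
    suffices to compare m = 0 and m = 1, where only n = 0 contributes and j(j+1)/2 = j^2. *)
Lemma diag_sum_eq M m : (m <= M)%N -> diag_sum tterm M.+1 m = diag_sum sterm M.+1 m.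
Proof.
have e0 j : 'C(j.+1, 2) = (j * j)%N -> tterm 0 j = sterm 0 j.
  by move=> e; rewrite /tterm /sterm e /ratio qpochE big_ord0 mul1r.
elim/ltn_ind: m => -[|[|m]] IH lemM.
- by rewrite !diag_sum_small ?e0.
- by rewrite !diag_sum_small ?e0.
apply: (@fps_cancel (1 - q ^+ m.+2)); first exact: qX0.
by rewrite diag_sum_tterm_rec ?diag_sum_sterm_rec ?IH //; lia.
Qed.

Lemma double_sum_eq M :
  eqm M (\sum_(n < M) \sum_(j < M) q ^+ (2 * n + j) * tterm n j)
        (\sum_(n < M) \sum_(j < M) q ^+ (2 * n + j) * sterm n j).
Proof.
refine (eqm_trans (@sum_diag tterm M) _).
refine (eqm_trans _ (eqm_sym (@sum_diag sterm M))).
by case: M => // M; apply: eqm_sum => m _; rewrite diag_sum_eq // -ltnS.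
Qed.

(* Generating function of the parts 2, 4, ..., 2n, each repeated at least twice. *)
Definition even_part n : fps := q ^+ (2 * n * (n + 1)) * iq 2 n.

Lemma gap_series_eq M :
  eqm M (\sum_(n < M) even_part n * gap2 (2 * n + 2))
        (\sum_(n < M) term11 (gap1 (2 * n + 2)) n).
Proof.
have e2 : eqm M (\sum_(n < M) even_part n * gap2 (2 * n + 2))
    (\sum_(n < M) \sum_(j < M) q ^+ (2 * n + j) * tterm n j).
  apply: eqm_sum => n _; apply: (@eqm_trans _
      (even_part n * \sum_(j < M) gap2_term (2 * n + 2) j)).
    by apply: eqmMl; apply: isumE => //; apply: gap2_adapted; lia.
  rewrite mulr_sumr; apply: eqm_sum => j _; rewrite /even_part /gap2_term /tterm.
  have e : (2 * n * (n + 1) + ((2 * n + 2) * j + j * j.-1) =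
            2 * n + j + (2 * n * n + 2 * n * j + j * j))%N.
    by case: (nat_of_ord j) => [|i] /=; ring.
  rewrite [X in eqm _ _ X]mulrA -exprD -e [q ^+ (2 * n * (n + 1) + _)]exprD.
  by apply: eqmW; ring.
have e1 : eqm M (\sum_(n < M) term11 (gap1 (2 * n + 2)) n)
    (\sum_(n < M) \sum_(j < M) q ^+ (2 * n + j) * sterm n j).
  apply: eqm_sum => n _; apply: (@eqm_trans _
      (q ^+ (2 * n * (n + 1)) * ratio n * \sum_(j < M) gap1_term (2 * n + 2) j)).
    apply: (@eqm_trans _ (q ^+ (2 * n * (n + 1)) * ratio n * gap1 (2 * n + 2))).
      apply: eqmW; rewrite -fqE.
      rewrite -[term11 _ _]/((fq (2 * n * (n + 1)) * qpoch (fq 1) (fq 2) n) *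
       (gap1 (2 * n + 2) * iq 2 n)).
      by rewrite /ratio; ring.
    by apply: eqmMl; apply: isumE => //; apply: gap1_adapted; lia.
  rewrite mulr_sumr; apply: eqm_sum => j _; rewrite /gap1_term /sterm.
  have e : (2 * n * (n + 1) + ((2 * n + 2) * j + 'C(j, 2)) =
            2 * n + j + (2 * n * n + 2 * n * j + 'C(j.+1, 2)))%N.
    by rewrite binS bin1; ring.
  rewrite [X in eqm _ _ X]mulrA -exprD -e [q ^+ (2 * n * (n + 1) + _)]exprD.
  by apply: eqmW; ring.
exact: eqm_trans e2 (eqm_trans (@double_sum_eq M) (eqm_sym e1)).
Qed.

(** * Counting the partitions *)

(* Admissibility of multiplicity [c] for the part [j] when [R_1 = 2h]
   and the part [j - 1] has multiplicity [p]. *)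
Definition part_ok (h j p c : nat) : bool :=
  if j == 0%N then c == 0%N
  else if (j <= (2 * h).+1)%N then (if odd j then c == 0%N else (1 < c)%N)
  else (c <= 1)%N && ~~ ((0 < p)%N && (0 < c)%N).

Fixpoint parts_ok (h j p : nat) (l : seq nat) : bool :=
  if l is c :: l' then part_ok h j p c && parts_ok h j.+1 c l' else true.

Fixpoint weight (j : nat) (l : seq nat) : nat :=
  if l is c :: l' then (j * c + weight j.+1 l')%N else 0%N.

(* Generating function of the admissible multiplicities, all below [B], of the
   [L] parts [j, ..., j+L-1], when part [j - 1] has multiplicity [p]. *)
Fixpoint parts_gf (B h L j p : nat) : fps :=
  if L is L'.+1 then
    \sum_(c < B | part_ok h j p c) q ^+ (j * c) * parts_gf B h L' j.+1 c
  else 1.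

Lemma big_tupleS (V : nmodType) (I : finType) L (F : seq I -> V) :
  \sum_(t : L.+1.-tuple I) F t = \sum_(x : I) \sum_(t : L.-tuple I) F (x :: t).
Proof.
rewrite pair_big /=.
rewrite (reindex (fun z : I * L.-tuple I => [tuple of z.1 :: z.2])) //=.
exists (fun t => (thead t, [tuple of behead t])) => [[x t] _ | t _] /=.
  by congr pair; apply: val_inj.
by rewrite -tuple_eta.
Qed.

Lemma parts_gfE B h L j p :
  parts_gf B h L j p =
  \sum_(t : L.-tuple 'I_B) if parts_ok h j p (map val t)
                           then q ^+ weight j (map val t) else 0.
Proof.
elim: L j p => [|L IH] j p /=.
  by rewrite (bigD1 [tuple]) //= big1 ?addr0 // => t /eqP[]; apply: tuple0.
rewrite (big_tupleS _ (fun l : seq 'I_B => if parts_ok h j p (map val l)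
   then q ^+ weight j (map val l) else 0)) /= big_mkcond.
apply: eq_bigr => c _; case: ifP => _ /=; last by rewrite big1.
rewrite IH mulr_sumr; apply: eq_bigr => t _.
by case: ifP => _; rewrite ?mulr0 // exprD.
Qed.

Lemma parts_gf_coef B h L j p w :
  parts_gf B h L j p w =
  (#|[set t : L.-tuple 'I_B | parts_ok h j p (map val t) &&
                              (weight j (map val t) == w)]|)%:R.
Proof.
rewrite parts_gfE fps_sumE -sum1_card natr_sum [RHS]big_mkcond /=.
apply: eq_bigr => t _; rewrite inE; case: ifP => _ //=.
by rewrite -fqE /fq eq_sym; case: eqP.
Qed.

(** Induction on the number of parts left, following [gap2_rec]: multiplicities 0 and 1 of part j
    give its two terms, and a present predecessor forces multiplicity 0. Parts from [B] on are
    invisible modulo q^B. *)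
Lemma parts_gf_tail B h L j p : (2 * h + 2 <= j)%N -> (j + L = B)%N ->
  eqm B (parts_gf B h L j p) (gap2 (if p == 0%N then j else j.+1)).
Proof.
elim: L j p => [|L IH] j p lej eB /=.
  apply: eqm_sym => k ltkB; apply: (@gap2_eqm1 (if p == 0%N then j else j.+1)).
    by case: ifP; lia.
  by case: ifP; lia.
have okE (c : nat) : part_ok h j p c = (c <= 1)%N && ~~ ((0 < p)%N && (0 < c)%N).
  by rewrite /part_ok !ifF //; lia.
under eq_bigl do rewrite okE.
(* Here B > j >= 2, so both multiplicities 0 and 1 lie below [B]. *)
case: B IH eB => [|[|B]] IH eB; try by exfalso; lia.
rewrite big_mkcond !big_ord_recl big1 ?addr0 => [|c _]; last by [].
rewrite /= andbF muln0 expr0 mul1r /bump /= add1n muln1 andbT.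
have IH0 := IH j.+1 0%N; have IH1 := IH j.+1 1%N; move: IH0 IH1 => /=.
case: (posnP p) => [_ | _] IH0 IH1 /=.
  rewrite gap2_rec; last by lia.
  by rewrite addr0; refine (eqmD (IH0 _ _) (eqmMl _ (IH1 _ _))); lia.
by rewrite !addr0; apply: IH0; lia.
Qed.

(** The term q^(jB) comes from bounding multiplicities by [B]; it vanishes modulo q^B for j > 0. *)
Lemma geometric_sum2 j B : (1 < B)%N ->
  (1 - q ^+ j) * (\sum_(c < B | (1 < c)%N) q ^+ (j * c)) = q ^+ (2 * j) - q ^+ (j * B).
Proof.
case: B => [|[|B]] // _; rewrite big_mkcond !big_ord_recl /= !add0r.
elim: B => [|B IH]; first by rewrite big_ord0 mulr0 mulnC subrr.
rewrite big_ord_recr /= mulrDr IH /bump /= !add1n [(j * B.+3)%N]mulnS exprD.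
by ring.
Qed.

(** Adjoining the part 2n+2 with multiplicity at least 2 multiplies by q^(2(2n+2))/(1 -
    q^(2n+2)). *)
Lemma even_partS n :
  (1 - q ^+ (2 * n.+1)) * even_part n.+1 = q ^+ (2 * (2 * n.+1)) * even_part n.
Proof.
rewrite /even_part -(iqS n (ltn0Sn 1)) [RHS]mulrA -exprD.
rewrite (_ : 2 * (2 * n.+1) + 2 * n * (n + 1) = 2 * n.+1 * (n.+1 + 1))%N; last by ring.
by ring.
Qed.

(** Up to 2h+1 admissibility ignores the preceding part: the absence of odd parts there already
    rules out consecutive ones. *)
Lemma parts_gf_prev B h L j p p' : (j <= (2 * h).+1)%N ->
  parts_gf B h L j p = parts_gf B h L j p'.
Proof.
by move=> lejh; case: L => //= L; apply: eq_bigl => c; rewrite /part_ok lejh.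
Qed.

Lemma parts_gf_odd B h L i p : (i <= h)%N -> (0 < B)%N ->
  parts_gf B h L.+1 (2 * i).+1 p = parts_gf B h L (2 * i).+2 0.
Proof.
move=> leih B_gt0; rewrite /= (big_pred1 (Ordinal B_gt0)) => [|c].
  by rewrite muln0 expr0 mul1r.
by rewrite /part_ok /= ltnS leq_mul2l leih orbT mul2n odd_double.
Qed.

Lemma parts_gf_even B h L i p : (i < h)%N ->
  parts_gf B h L.+1 (2 * i.+1) p =
  (\sum_(c < B | (1 < c)%N) q ^+ (2 * i.+1 * c)) * parts_gf B h L (2 * i.+1).+1 0.
Proof.
move=> ltih; rewrite mulr_suml; apply: eq_big => [c | c _].
  by rewrite /part_ok ifT ?ifF ?mul2n ?odd_double //; lia.
by congr (_ * _); apply: parts_gf_prev; lia.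
Qed.

(** Induction on h - i: the absent part 2i+1 and the repeated part 2i+2 turn [even_part i] into
    [even_part i.+1], until i = h, where [gap2] gives the tail. *)
Lemma parts_gf_head B h L i p : (i <= h)%N -> (2 * h < B)%N -> ((2 * i).+1 + L = B)%N ->
  eqm B (even_part i * parts_gf B h L (2 * i).+1 p) (even_part h * gap2 (2 * h + 2)).
Proof.
move=> leih; have [d def_h] : {d | (i + d = h)%N} by exists (h - i)%N; lia.
elim: d i p L def_h leih => [|d IH] i p L def_h leih lthB eB.
  move: eB; rewrite addn0 in def_h; rewrite def_h => eB; apply: eqmMl.
  case: L eB => [|L] eB.
    by apply: eqm_sym => k ltkB; apply: (@gap2_eqm1 (2 * h + 2)); lia.
  rewrite parts_gf_odd //; last by lia.
  rewrite addn2; apply: (@parts_gf_tail _ _ _ _ 0); lia.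
case: L eB => [|[|L]] eB; try by exfalso; lia.
rewrite parts_gf_odd //; last by lia.
rewrite -[(2 * i).+2]/(2 + 2 * i)%N -mulnS parts_gf_even; last by lia.
set G := \sum_(c < B | _) _; set X := parts_gf _ _ _ _ _.
have eG : eqm B ((1 - q ^+ (2 * i.+1)) * G) (q ^+ (2 * (2 * i.+1))).
  rewrite geometric_sum2; last by lia.
  move=> k ltkB; rewrite fps_addE fps_oppE -[q ^+ (_ * B)]mulr1.
  by rewrite (@eqm_qX B) ?subr0 //; nia.
apply: (@eqm_cancel _ (1 - q ^+ (2 * i.+1))); first exact: qX0.
have -> : (1 - q ^+ (2 * i.+1)) * (even_part i * (G * X)) =
   (1 - q ^+ (2 * i.+1)) * G * (even_part i * X) by ring.
apply: (@eqm_trans _ ((1 - q ^+ (2 * i.+1)) * (even_part i.+1 * X))).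
  by rewrite [Y in eqm _ _ Y]mulrA even_partS -[Y in eqm _ _ Y]mulrA; apply: eqmM.
by apply: eqmMl; apply: IH; lia.
Qed.

Lemma parts_gf_total B h p : (2 * h < B)%N ->
  eqm B (parts_gf B h B 0 p) (even_part h * gap2 (2 * h + 2)).
Proof.
case: B => // B lthB; rewrite /= (big_pred1 (Ordinal (ltn0Sn B))) // mul0n expr0 mul1r.
have := @parts_gf_head B.+1 h B 0 0 isT lthB erefl.
by rewrite /even_part iq0 mulr1 expr0 mul1r.
Qed.

(** * From local conditions on multiplicity lists to T *)

Lemma parts_okP h j p (l : seq nat) :
  reflect (forall i, (i < size l)%N ->
             part_ok h (j + i) (nth 0%N (p :: l) i) (nth 0%N l i))
          (parts_ok h j p l).
Proof.
elim: l j p => [|c l IH] j p /=; first by apply: ReflectT.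
apply: (iffP andP) => [[ok_c /IH ok_l] [|i] lti | ok].
- by rewrite addn0.
- by rewrite addnS -addSn; apply: ok_l.
split; first by have := ok 0%N isT; rewrite addn0.
by apply/IH => i lti; have := ok i.+1 lti; rewrite addnS -addSn.
Qed.

Lemma weightE j (l : seq nat) :
  weight j l = (\sum_(i < size l) (j + i) * nth 0 l i)%N.
Proof.
elim: l j => [|c l IH] j /=; first by rewrite big_ord0.
rewrite big_ord_recl /= addn0 IH; congr (_ + _)%N.
by apply: eq_bigr => i _; rewrite /bump /= add1n addnS.
Qed.

Lemma R1_ge N (f : nat -> nat) j : (j <= N)%N -> (1 < f j)%N -> (j <= R1 N f)%N.
Proof.
move=> lejN fj; rewrite /R1.
exact: (@leq_bigmax_cond _ (fun j : 'I_N.+1 => (1 < f j)%N) _ (Ordinal (lejN : j < N.+1)%N)).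
Qed.

Lemma R1_attained N (f : nat -> nat) : (0 < R1 N f)%N ->
  (R1 N f <= N)%N /\ (1 < f (R1 N f))%N.
Proof.
rewrite /R1; elim/big_ind: _ => // [x y IHx IHy | j fj _].
  by rewrite /maxn; case: ifP.
by split; rewrite ?leq_ord.
Qed.

(** For fixed R_1 = 2h the conditions are local. Since odd parts up to 2h+1 are absent, consecutive
    parts could only occur beyond 2h+1, where multiplicities are at most 1. *)
Lemma T_ok_R1 N h (l : seq nat) : size l = N.+1 -> (2 * h <= N)%N ->
  T_ok N (nth 0%N l) && (R1 N (nth 0%N l) == 2 * h)%N =
  parts_ok h 0 0 l && (weight 0 l == N).
Proof.
move=> sz_l lehN; pose f := nth 0%N l; rewrite -/f.
have fout j : (N < j)%N -> f j = 0%N by move=> ?; rewrite /f nth_default ?sz_l.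
have wE : weight 0 l = (\sum_(j < N.+1) j * f j)%N.
  by rewrite weightE sz_l; apply: eq_bigr => j _; rewrite add0n.
apply/idP/idP.
  case/andP=> /and5P[/eqP f0 wN odd1 odd0 /andP[even2 gap]] /eqP R1E.
  rewrite wE wN andbT; apply/parts_okP => j; rewrite sz_l ltnS add0n => lejN.
  rewrite -[nth 0%N l j]/(f j) /part_ok; case: eqP => [-> | /eqP j0]; first by rewrite f0.
  pose jo := Ordinal (lejN : j < N.+1)%N.
  have {}odd0 := forallP odd0 jo; have {}even2 := forallP even2 jo.
  rewrite R1E /= in odd0 even2.
  case: (leqP j (2 * h).+1) => lejh.
    case: ifP odd0 even2 => oddj /=.
      by move=> /implyP odd0 _; apply: odd0; lia.
    (* Part 2h itself is outside the strict bound j < R_1; its multiplicity comes from R_1 being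
       attained. *)
    move=> _; rewrite lt0n j0 /=; case: ltngtP => // [|ejh _]; first by lia.
    by have [|_] := @R1_attained N f; rewrite R1E -ejh ?lt0n.
  apply/andP; split.
    by rewrite leqNgt; apply/negP => /(R1_ge lejN); rewrite R1E; lia.
  case: j {j0 lejh odd0 even2 jo} lejN => [|j] lejN; first by rewrite f0 andbF.
  exact: (forallP gap (Ordinal (ltnW lejN : j < N.+1)%N)).
case/andP=> /parts_okP ok wN; rewrite sz_l in ok.
have f0 : f 0%N = 0%N by exact/eqP/(ok 0%N isT).
have ok_odd j : (j <= (2 * h).+1)%N -> odd j -> f j = 0%N.
  move=> lejh oddj; case: (ltnP N j) => [/fout // | lejN].
  have := ok j lejN; rewrite add0n /part_ok lejh oddj; case: eqP => [e | _] /eqP //.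
have ok_even j : (0 < j <= 2 * h)%N -> ~~ odd j -> (1 < f j)%N.
  move=> /andP[j0 lejh] /negbTE evj.
  by have := ok j (leq_trans lejh lehN); rewrite add0n /part_ok leqW // evj eqn0Ngt j0.
have ok_tail j : ((2 * h).+1 < j)%N -> (f j <= 1)%N && ~~ ((0 < f j.-1)%N && (0 < f j)%N).
  move=> lthj; case: (ltnP N j) => [/fout -> | lejN]; first by rewrite andbF.
  have := ok j lejN; rewrite add0n /part_ok ifF; last by lia.
  by rewrite leqNgt lthj /=; case: j lthj {lejN}.
have R1E : R1 N f = (2 * h)%N.
  apply/eqP; rewrite eqn_leq; apply/andP; split.
    apply/bigmax_leqP => j fj; rewrite leqNgt; apply/negP => lthj.
    case: (ltnP (2 * h).+1 j) => [/ok_tail | lejh]; first by lia.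
    by rewrite (ok_odd _ lejh) in fj => //; lia.
  case: (posnP h) => [-> // | h0]; apply: R1_ge => //; apply: ok_even; first by lia.
  by rewrite mul2n odd_double.
rewrite /T_ok R1E eqxx andbT f0 eqxx -wE wN /=; apply/and4P; split.
- apply/forallP => j; apply/implyP => oddj.
  case: (ltnP (2 * h).+1 j) => [/ok_tail /andP[] // | lejh]; by rewrite ok_odd.
- apply/forallP => j; apply/implyP => /andP[oddj lejh]; rewrite ok_odd //; lia.
- apply/forallP => j; apply/implyP => /andP[evj lejh]; apply: ok_even => //; lia.
apply/forallP => j; case: (ltnP (2 * h).+1 j.+1) => [/ok_tail /andP[] // | lejh].
case oddj: (odd j); first by rewrite ok_odd //; lia.
by rewrite (ok_odd j.+1) ?andbF //= oddj.
Qed.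

(** A positive R_1 is a part of multiplicity at least 2, whereas odd parts have multiplicity at most
    1. *)
Lemma T_ok_R1_even N (f : nat -> nat) : T_ok N f ->
  exists2 h : 'I_N.+1, (2 * h <= N)%N & R1 N f = (2 * h)%N.
Proof.
case/and5P=> _ _ /forallP odd1 _ _.
case: (posnP (R1 N f)) => [-> | /R1_attained[leRN fR]]; first by exists ord0.
have evR : ~~ odd (R1 N f).
  by apply/negP => oddR; have := odd1 (Ordinal (leRN : R1 N f < N.+1)%N); rewrite /= oddR; lia.
have lth : ((R1 N f)./2 < N.+1)%N by lia.
by exists (Ordinal lth) => /=; lia.
Qed.

Lemma T_tuples N : T N = #|[set t : N.+1.-tuple 'I_N.+1 | T_ok N (nth 0%N (map val t))]|.
Proof.
pose g (t : N.+1.-tuple 'I_N.+1) := [ffun i => tnth t i].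
have g_inj : injective g.
  by move=> t u /ffunP e; apply: eq_from_tnth => i; have := e i; rewrite !ffunE.
have g_bij : bijective g.
  by apply: (inj_card_bij g_inj); rewrite card_ffun card_tuple !card_ord.
have mult_g t j : mult_of (g t) j = nth 0%N (map val t) j.
  rewrite /mult_of; case: ltnP => ltj; last by rewrite nth_default // size_map size_tuple.
  rewrite ffunE (tnth_nth ord0) inordK // (nth_map ord0) ?size_tuple //.
have Text f1 f2 : f1 =1 f2 -> T_ok N f1 = T_ok N f2.
  by move=> /funext ->.
rewrite /T -(card_imset _ g_inj); apply: eq_card => m; rewrite inE.
have [g' g'K gK] := g_bij.
rewrite -[m in RHS]gK mem_imset // inE -[m in LHS]gK.
by apply: Text => j; rewrite mult_g.
Qed.

(** Each counted partition has exactly one h with R_1 = 2h, so T splits over h and [parts_gf] counts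
    each class. *)
Lemma T_gap_series N : (T N)%:Z = (\sum_(h < N.+1) even_part h * gap2 (2 * h + 2)) N.
Proof.
rewrite T_tuples fps_sumE.
pose A (t : N.+1.-tuple 'I_N.+1) (h : 'I_N.+1) :=
  [&& (2 * h <= N)%N, parts_ok h 0 0 (map val t) & weight 0 (map val t) == N].
have AE t h : A t h = (2 * h <= N)%N && (T_ok N (nth 0%N (map val t)) &&
    (R1 N (nth 0%N (map val t)) == 2 * h)%N).
  by rewrite /A; case: leqP => //= leh; rewrite T_ok_R1 // size_map size_tuple.
have Tsum (t : N.+1.-tuple 'I_N.+1) :
    (T_ok N (nth 0%N (map val t)) : nat) = (\sum_(h < N.+1) A t h)%N.
  case: (boolP (T_ok _ _)) => [ok | /negbTE nok]; last first.
    by rewrite big1 // => h _; rewrite AE nok andbF.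
  have [h leh R1E] := T_ok_R1_even ok.
  rewrite (bigD1 h) //= AE leh ok R1E eqxx big1 // => h' ne_h'.
  rewrite AE R1E; case: eqP => [e|]; last by rewrite !andbF.
  by case/eqP: ne_h'; apply: val_inj => /=; lia.
rewrite -sum1_card big_mkcond /=.
rewrite (eq_bigr (fun t => \sum_(h < N.+1) A t h)%N) => [|t _]; last first.
  by rewrite inE -Tsum; case: ifP.
rewrite exchange_big /= -natz natr_sum; apply: eq_bigr => h _.
case: (leqP (2 * h) N) => [leh | lth]; last first.
  rewrite big1 => [|t _]; last by rewrite AE leqNgt lth.
  (* If 2h > N, the summand is a multiple of q^(2h(h+1)) and 2h(h+1) > N. *)
  rewrite /even_part -mulrA (@eqm_qX N.+1) //; nia.
rewrite -(@parts_gf_total N.+1 h 0) // parts_gf_coef -sum1_card.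
rewrite [in RHS]big_mkcond; congr (_%:R); apply: eq_bigr => t _.
by rewrite inE /A leh /=; case: ifP.
Qed.

Theorem theorem11 :
  exists P : nat -> fps,
    (forall n, fconv (fun m => qpoch (fopp (fq (2 * n + 2))) (fq 1) m) (P n)) /\
    fconv (fun N => fsum N (fun n => term11 (P n) n)) (fun k => ((T k)%:Z)%R).
Proof.
(* By [gap1_conv], this witness is the limit (-q^(2n+2);q)_oo. *)
exists (fun n => gap1 (2 * n + 2)); split=> [n|k]; first by apply: gap1_conv; lia.
exists k.+1 => m lekm; rewrite T_gap_series (@gap_series_eq k.+1) // fps_sumE /fsum.
rewrite -(big_mkord xpredT (fun n => term11 (gap1 (2 * n + 2)) n k)).
(* Summands with n > k are multiples of q^(2n(n+1)) and do not reach coefficient k. *)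
rewrite (@big_cat_nat _ _ _ k.+1) //= big_mkord.
rewrite [X in _ + X]big_nat_cond [X in _ + X]big1 ?addr0 // => n /andP[/andP[ltkn _] _].
rewrite -[term11 _ _]/(fq (2 * n * (n + 1)) * qpoch (fq 1) (fq 2) n *
       (gap1 (2 * n + 2) * iq 2 n)) -mulrA fqE.
by rewrite (@eqm_qX k.+1) //; nia.
Qed.
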